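(* Let $NS_2=\langle a,b\mid bab^{-1}a\rangle$ be the Klein bottle group, and let $G=G_1\times\cdots\times G_n$ ($n\geq 1$), where each $G_i$ is a surface group of Euclidean type, i.e., each $G_i$ is one of $1$, $\mathbb{Z}$, $\mathbb{Z}^2$, $\mathbb{Z}/2\mathbb{Z}$, $NS_2$. Then the following are equivalent: (a) $\mathrm{Fix}\,\phi$ is inert in $G$ for every endomorphism $\phi\in\mathrm{End}(G)$; (b) $\mathrm{Fix}\,\phi$ is inert in $G$ for every automorphism $\phi\in\mathrm{Aut}(G)$; (c) $G$ is (isomorphic to a group) of one of the following forms: (euc1) $\mathbb{Z}^p\times(\mathbb{Z}/2\mathbb{Z})^q$ for some $p,q\geq 0$; or (euc2) $NS_2\times(\mathbb{Z}/2\mathbb{Z})^q$ for some $q\geq 0$.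
   Context: For a finitely generated group $K$, $\mathrm{rk}(K)$ denotes the minimal number of generators of $K$. (All subgroups of the groups $G$ considered here are finitely generated.) A subgroup $H\leq G$ is inert in $G$ if $\mathrm{rk}(H\cap K)\leq\mathrm{rk}(K)$ for every finitely generated subgroup $K\leq G$. For $\phi\in\mathrm{End}(G)$, $\mathrm{Fix}\,\phi=\{g\in G\mid\phi(g)=g\}$. *)

(* Defs.v *)
From HB Require Import structures.
From mathcomp Require Import all_boot all_algebra.
From mathcomp Require Import generic_quotient.
From mathcomp Require Import boolp classical_sets.

Set Implicit Arguments.
Unset Strict Implicit.
Unset Printing Implicit Defensive.

Local Open Scope classical_set_scope.
Local Open Scope group_scope.
Local Open Scope quotient_scope.

Definition is_subgroup (G : groupType) (H : set G) : Prop :=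
  group_closed [pred x | x \in H].

Definition generated (G : groupType) (A : set G) : set G :=
  smallest (@is_subgroup G) A.

Definition generated_by_n (G : groupType) (K : set G) (n : nat) : Prop :=
  exists s : seq G, size s = n /\ generated [set` s] = K.

Definition finitely_generated (G : groupType) (K : set G) : Prop :=
  exists n, generated_by_n K n.

Lemma ex_generated_by_n (G : groupType) (K : set G) :
  finitely_generated K -> exists n, `[< generated_by_n K n >].
Proof. by case=> n Kn; exists n; apply/asboolP. Qed.

(* 0 is a dummy value, for K not finitely generated: [inert] only compares
   ranks of finitely generated subgroups. *)
Definition rk (G : groupType) (K : set G) : nat :=
  if pselect (finitely_generated K) is left fgK
  then ex_minn (ex_generated_by_n fgK) else 0%N.

(* Requiring H `&` K to be finitely generated amounts to reading the rank of
   a subgroup that is not as infinite. *)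
Definition inert (G : groupType) (H : set G) : Prop :=
  is_subgroup H /\
  forall K : set G, finitely_generated K ->
    finitely_generated (H `&` K) /\ (rk (H `&` K) <= rk K)%N.

Definition Fix (G : groupType) (phi : G -> G) : set G := [set g | phi g = g].

Definition isomorphic (G H : groupType) : Prop :=
  exists f : {multiplicative G -> H}, bijective f.

Section DirectProduct.
Variables (I : finType) (Gs : I -> groupType).
Local Notation prodT := {dffun forall i : I, Gs i}.

Definition dprod_mul (f g : prodT) : prodT := [ffun i => f i * g i].
Definition dprod_one : prodT := [ffun i => (1 : Gs i)].
Definition dprod_inv (f : prodT) : prodT := [ffun i => (f i)^-1].

Fact dprod_mulA : associative dprod_mul.
Proof. by move=> f g h; apply/ffunP=> i; rewrite !ffunE mulgA. Qed.
Fact dprod_mul1 : left_id dprod_one dprod_mul.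
Proof. by move=> f; apply/ffunP=> i; rewrite !ffunE mul1g. Qed.
Fact dprod_mulr1 : right_id dprod_one dprod_mul.
Proof. by move=> f; apply/ffunP=> i; rewrite !ffunE mulg1. Qed.
Fact dprod_mulV : left_inverse dprod_one dprod_inv dprod_mul.
Proof. by move=> f; apply/ffunP=> i; rewrite !ffunE mulVg. Qed.
Fact dprod_mulrV : right_inverse dprod_one dprod_inv dprod_mul.
Proof. by move=> f; apply/ffunP=> i; rewrite !ffunE mulgV. Qed.

HB.instance Definition _ := isGroup.Build prodT
  dprod_mulA dprod_mul1 dprod_mulr1 dprod_mulV dprod_mulrV.
End DirectProduct.

Definition direct_product (I : finType) (Gs : I -> groupType) : groupType :=
  {dffun forall i : I, Gs i}.

(* A word in the letters x^{+-1}: (x, false) stands for x, (x, true) for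
   x^-1. *)
Definition word (X : Type) := seq (X * bool).

Definition winv (X : Type) (w : word X) : word X :=
  rev [seq (l.1, ~~ l.2) | l <- w].

(* The congruence on words whose quotient is the group <X | R>. *)
Inductive pres_eq (X : Type) (R : set (word X)) : word X -> word X -> Prop :=
| pres_refl w : pres_eq R w w
| pres_sym v w : pres_eq R v w -> pres_eq R w v
| pres_trans u v w : pres_eq R u v -> pres_eq R v w -> pres_eq R u w
| pres_cat u v u' v' :
    pres_eq R u u' -> pres_eq R v v' -> pres_eq R (u ++ v) (u' ++ v')
| pres_cancel x b : pres_eq R [:: (x, b); (x, ~~ b)] [::]
| pres_rel r : R r -> pres_eq R r [::].

Section Presentation.
Variables (X : choiceType) (R : set (word X)).
HB.instance Definition _ := Choice.on (word X).

Definition pres_eqb : rel (word X) := fun v w => `[< pres_eq R v w >].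

Fact pres_eqb_refl : reflexive pres_eqb.
Proof. by move=> w; apply/asboolP/pres_refl. Qed.
Fact pres_eqb_sym : symmetric pres_eqb.
Proof. by move=> v w; apply/asboolP/asboolP => /pres_sym. Qed.
Fact pres_eqb_trans : transitive pres_eqb.
Proof.
by move=> v u w /asboolP uv /asboolP vw; apply/asboolP/(pres_trans uv vw).
Qed.

Canonical pres_equiv := EquivRel pres_eqb
  pres_eqb_refl pres_eqb_sym pres_eqb_trans.

Definition presented := {eq_quot pres_equiv}.
HB.instance Definition _ := Choice.on presented.
HB.instance Definition _ := Quotient.on presented.

Definition pres_class (w : word X) : presented := \pi_presented w.

Lemma pres_classP v w : pres_class v = pres_class w <-> pres_eq R v w.
Proof.
rewrite /pres_class; split=> [/eqmodP/asboolP//|vw].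
by apply/eqmodP/asboolP.
Qed.

Lemma pres_class_repr (x : presented) : pres_class (repr x) = x.
Proof. exact: reprK. Qed.

Definition pres_one : presented := pres_class [::].
Definition pres_mul (x y : presented) : presented :=
  pres_class (repr x ++ repr y).
Definition pres_inv (x : presented) : presented := pres_class (winv (repr x)).

Lemma pres_classM v w :
  pres_mul (pres_class v) (pres_class w) = pres_class (v ++ w).
Proof.
by apply/pres_classP/pres_cat; apply/pres_classP; rewrite pres_class_repr.
Qed.

Lemma pres_winvl (w : word X) : pres_eq R (winv w ++ w) [::].
Proof.
elim: w => [|[x b] w IHw]; first exact: pres_refl.
rewrite /winv /= rev_cons cat_rcons -cat1s -/(winv w) -[(x, b) :: w]cat1s.
apply: pres_trans IHw; apply: pres_cat; first exact: pres_refl.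
rewrite catA -[X in pres_eq R _ X]cat0s; apply: pres_cat (pres_refl _ _).
by have /= := pres_cancel R x (~~ b); rewrite negbK.
Qed.

Lemma winvK : involutive (@winv X).
Proof.
move=> w; rewrite /winv map_rev revK -map_comp -[RHS]map_id.
by apply: eq_map => -[x b] /=; rewrite negbK.
Qed.

Fact pres_mulA : associative pres_mul.
Proof.
move=> x y z; rewrite -[x]pres_class_repr -[y]pres_class_repr.
by rewrite -[z]pres_class_repr !pres_classM catA.
Qed.
Fact pres_mul1 : left_id pres_one pres_mul.
Proof. by move=> x; rewrite -[x]pres_class_repr pres_classM. Qed.
Fact pres_mulr1 : right_id pres_one pres_mul.
Proof. by move=> x; rewrite -[x]pres_class_repr pres_classM cats0. Qed.
Fact pres_mulV : left_inverse pres_one pres_inv pres_mul.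
Proof.
move=> x; rewrite -[X in pres_mul _ X]pres_class_repr pres_classM.
exact/pres_classP/pres_winvl.
Qed.
Fact pres_mulrV : right_inverse pres_one pres_inv pres_mul.
Proof.
move=> x; rewrite -[X in pres_mul X _]pres_class_repr pres_classM.
by apply/pres_classP; rewrite -{1}[repr x]winvK; apply: pres_winvl.
Qed.

HB.instance Definition _ := isGroup.Build presented
  pres_mulA pres_mul1 pres_mulr1 pres_mulV pres_mulrV.
End Presentation.

Definition trivial_group : groupType := Algebra.to_multiplicative 'I_1.

Definition Zgroup : groupType := Algebra.to_multiplicative int.

Definition C2 : groupType := Algebra.to_multiplicative 'Z_2.

(* b a b^-1 a, where the generators are a = ord0 and b = ord_max. *)
Definition klein_relator : word 'I_2 :=
  [:: (ord_max, false); (ord0, false); (ord_max, true); (ord0, false)].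

Definition NS2 : groupType := presented [set klein_relator].

Definition euclidean_surface_group (G : groupType) : Prop :=
  isomorphic G trivial_group \/ isomorphic G Zgroup \/
  isomorphic G (Zgroup * Zgroup)%type \/ isomorphic G C2 \/
  isomorphic G NS2.

Definition power (G : groupType) (n : nat) : groupType := {ffun 'I_n -> G}.

(* Main.v *)
Require Import Defs.
From HB Require Import structures.
From mathcomp Require Import all_boot all_algebra.
From mathcomp Require Import generic_quotient.
From mathcomp Require Import boolp classical_sets.
From mathcomp Require Import zify ring.

(* In the groups of (c) every subgroup H of an n-generated subgroup K is
   n-generated, whether or not it is a group of fixed points.  Each of these
   groups has a homomorphism f to Z whose kernel is abelian and on which every
   conjugation maps each element to itself or to its inverse: for
   NS_2 x (Z/2)^q take the exponent of b, for abelian groups f = 0.  If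
   f(K) <> 0, Nielsen moves put n - 1 of the generators of K in ker f, where
   they generate K & ker f, because all subgroups of ker f are normal.  Hence
   H & ker f, a subgroup of an (n - 1)-generated abelian group, is
   (n - 1)-generated, and H needs one more generator.

   Otherwise G is NS_2 x L for some L with a homomorphism h onto Z.  Let
   h(t) = 1.  The automorphism a |-> a, b |-> ab of NS_2, extended by the
   identity of L, fixes the elements of K = <b, at> with even exponent of b.
   They include a^2, b^2 and t^2, and the exponents of a and b together with h
   are additive on them, so that they do not form a 2-generated group. *)

Set Implicit Arguments.
Unset Strict Implicit.
Unset Printing Implicit Defensive.

Import GRing.Theory Num.Theory.
Local Open Scope classical_set_scope.
Local Open Scope group_scope.

(** * Ranks of subgroups *)

Section IntegerPowers.
Variable G : groupType.
Implicit Types (x y : G) (k l : int).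

Definition zexpg x k : G :=
  match k with Posz n => x ^+ n | Negz n => x ^- n.+1 end.

Lemma zexpgS x k : zexpg x (1 + k)%R = x * zexpg x k.
Proof.
case: k => [n|n]; first by rewrite -expgS.
rewrite NegzE; have -> : (1 - n.+1%:Z = - n%:Z)%R by lia.
case: n => [|n]; first by rewrite /= mulgV.
rewrite -(NegzE n) [LHS]/= -(NegzE n.+1) [in RHS]/=.
by rewrite (expgSr x n.+1) invgM mulVKg.
Qed.

Lemma zexpgP x k : zexpg x (k - 1)%R = x^-1 * zexpg x k.
Proof.
by apply: (@mulgI _ x); rewrite mulVKg -zexpgS addrCA subrr addr0.
Qed.

Lemma zexpgD x k l : zexpg x (k + l)%R = zexpg x k * zexpg x l.
Proof.
elim/int_rec: k => [|n IHn|n IHn]; first by rewrite add0r mul1g.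
  by rewrite intS -addrA !zexpgS IHn mulgA.
have -> : (- n.+1%:Z + l = - n%:Z + l - 1)%R by lia.
have -> : (- n.+1%:Z = - n%:Z - 1)%R by lia.
by rewrite !zexpgP IHn mulgA.
Qed.

Lemma zexpgN x k : zexpg x (- k)%R = (zexpg x k)^-1.
Proof. by apply: (@mulIg _ (zexpg x k)); rewrite -zexpgD addNr mulVg. Qed.

Lemma zexpgA x k l : zexpg (zexpg x k) l = zexpg x (l * k)%R.
Proof.
elim/int_rec: l => [|n IHn|n IHn]; first by rewrite mul0r.
  by rewrite intS zexpgS IHn mulrDl mul1r zexpgD.
have -> : (- n.+1%:Z * k = - k + - n%:Z * k)%R by rewrite intS; ring.
have -> : (- n.+1%:Z = - n%:Z - 1)%R by lia.
by rewrite zexpgP IHn zexpgD zexpgN.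
Qed.

Lemma zexpgMl x y k : commute x y -> zexpg (x * y) k = zexpg x k * zexpg y k.
Proof.
move=> cxy; case: k => n /=; first by rewrite expgMn.
by rewrite expgMn // invgM; apply/commute_sym/commuteV/commute_sym/commuteV/commuteX2.
Qed.

Lemma conj_zexpg x y k : zexpg x k ^ y = zexpg (x ^ y) k.
Proof. by case: k => n /=; rewrite ?conjVg conjXg. Qed.
End IntegerPowers.

(** * Subgroups and generating sequences *)

Section Subgroups.
Variable G : groupType.
Implicit Types (x y : G) (H K : set G) (s t : seq G).

Lemma is_subgroupP H :
  is_subgroup H <-> H 1 /\ (forall x y, H x -> H y -> H (x / y)).
Proof.
split=> -[H1 HF]; split; first exact: set_mem H1.
- by move=> x y /mem_set Hx /mem_set Hy; apply/set_mem/HF.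
- exact: mem_set.
- by move=> x y /set_mem Hx /set_mem Hy; apply/mem_set/HF.
Qed.

Section Closure.
Variable H : set G.
Hypothesis sgH : is_subgroup H.

Lemma subgroup1 : H 1.
Proof. by have /is_subgroupP[] := sgH. Qed.

Lemma subgroupF x y : H x -> H y -> H (x / y).
Proof. by have /is_subgroupP[_] := sgH; apply. Qed.

Lemma subgroupV x : H x -> H x^-1.
Proof. by move=> Hx; rewrite -div1g; apply: subgroupF => //; apply: subgroup1. Qed.

Lemma subgroupM x y : H x -> H y -> H (x * y).
Proof. by move=> Hx /subgroupV Hy; rewrite -[y]invgK; apply: subgroupF. Qed.

Lemma subgroupZ k x : H x -> H (zexpg x k).
Proof.
move=> Hx; have HX n : H (x ^+ n).
  by elim: n => [|n IHn]; [apply: subgroup1|rewrite expgS; apply: subgroupM].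
by case: k => n //=; apply: subgroupV.
Qed.
End Closure.

Lemma subgroupI H K : is_subgroup H -> is_subgroup K -> is_subgroup (H `&` K).
Proof.
move=> sgH sgK; apply/is_subgroupP; split; first by split; apply: subgroup1.
by move=> x y [Hx Kx] [Hy Ky]; split; apply: subgroupF.
Qed.

Lemma generated_subgroup (A : set G) : is_subgroup (generated A).
Proof.
apply/is_subgroupP; split=> [B [/is_subgroupP[]]//|x y gx gy B [sgB AB]].
by apply: subgroupF => //; [apply: gx|apply: gy].
Qed.

Lemma sub_generated (A : set G) x : A x -> generated A x.
Proof. by move=> Ax B [_]; apply. Qed.

Lemma generated_min (A H : set G) :
  is_subgroup H -> (forall x, A x -> H x) -> forall x, generated A x -> H x.
Proof. by move=> sgH AH x; apply. Qed.

Lemma generated_mono (A B : set G) :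
  (forall x, A x -> generated B x) -> forall x, generated A x -> generated B x.
Proof. by apply: generated_min; apply: generated_subgroup. Qed.

Lemma generated_eq (A B : set G) : (forall x, A x -> generated B x) ->
  (forall x, B x -> generated A x) -> generated A = generated B.
Proof. by move=> AB BA; apply/seteqP; split; apply: generated_mono. Qed.

Lemma mem_generated s x : x \in s -> generated [set` s] x.
Proof. by move=> sx; apply: sub_generated. Qed.

Lemma generated_cons_sub x s y : generated [set` s] y -> generated [set` x :: s] y.
Proof.
apply: generated_mono => {}y /= sy.
by apply: mem_generated; rewrite inE sy orbT.
Qed.

Lemma generated_cons_eq x s t :
  generated [set` s] = generated [set` t] ->
  generated [set` x :: s] = generated [set` x :: t].
Proof.
move=> st; apply: generated_eq => y /=; rewrite inE => /orP[/eqP->|/mem_generated sy];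
  try by apply: mem_generated; rewrite inE eqxx.
  by apply: generated_cons_sub; rewrite -st.
by apply: generated_cons_sub; rewrite st.
Qed.

(** The products x^k r are closed under division: in x^k (r / q) x^-l the factor r / q moves to the
    right of x^-l at the cost of a conjugation by a power of x, which preserves <s>. *)
Lemma generated_cons_normal x s :
  (forall y k, generated [set` s] y -> generated [set` s] (y ^ zexpg x k)) ->
  forall y, generated [set` x :: s] y ->
    exists k r, generated [set` s] r /\ y = zexpg x k * r.
Proof.
move=> nsx; have sgs := generated_subgroup [set` s].
apply: (@generated_min _ [set y | exists k r, generated [set` s] r /\ y = zexpg x k * r]).
  apply/is_subgroupP; split=> [|_ _ [k [r [sr ->]]] [l [q [sq ->]]]].
    by exists 0%R, 1; split; [apply: subgroup1|rewrite mul1g].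
  exists (k - l)%R, ((r / q) ^ zexpg x (- l)); split.
    by apply: nsx; apply: (subgroupF sgs).
  by rewrite zexpgD -[RHS]mulgA -conjgC zexpgN invgM !mulgA.
move=> y /=; rewrite inE => /orP[/eqP->|sy].
  by exists 1%R, 1; split; [apply: subgroup1|rewrite mulg1].
by exists 0%R, y; split; [apply: mem_generated|rewrite mul1g].
Qed.

(* N plays the part of a kernel with H / (H & N) cyclic, generated by h. *)
Lemma generated_cyclic_ext H (N : set G) h t :
  is_subgroup H -> H h -> generated [set` t] = H `&` N ->
  (forall g, H g -> exists k, N (g * zexpg h k)) ->
  generated [set` h :: t] = H.
Proof.
move=> sgH Hh gent cyc; apply/seteqP; split=> g.
  apply: generated_min => // x /=; rewrite inE => /orP[/eqP->//|/mem_generated].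
  by rewrite gent => -[].
move=> Hg; have [k Ngk] := cyc g Hg.
have sg := generated_subgroup [set` h :: t].
have gh : generated [set` h :: t] (zexpg h k).
  by apply: (subgroupZ sg _); apply: mem_generated; rewrite inE eqxx.
rewrite -[g](mulgK (zexpg h k)); apply: (subgroupF sg) => //.
apply: generated_cons_sub; rewrite gent; split=> //.
by apply: (subgroupM sgH) => //; apply: (subgroupZ sgH _).
Qed.
End Subgroups.

(** Division with remainder by the least positive element of S; if there is none, S is {0} and d =
    0. Positive integers are written [n.+1]. *)
Lemma int_subgroup_principal (S : int -> Prop) :
  S 0%R -> (forall k l, S k -> S l -> S (k - l)%R) ->
  exists2 d, S d & forall k, S k -> exists m, k = (m * d)%R.
Proof.
move=> S0 SB.
have SN k : S k -> S (- k)%R by move=> Sk; rewrite -sub0r; apply: SB.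
have SD k l : S k -> S l -> S (k + l)%R.
  by move=> Sk Sl; rewrite -[l]opprK; apply: SB => //; apply: SN.
have SM k m : S k -> S (m * k)%R.
  move=> Sk; elim/int_rec: m => [|n IHn|n IHn]; first by rewrite mul0r.
    by rewrite intS mulrDl mul1r; apply: SD.
  have -> : (- n.+1%:Z * k = - n%:Z * k - k)%R by rewrite intS; ring.
  exact: SB.
have [[n Sn]|no] := pselect (exists n : nat, S n.+1%:Z%R); last first.
  exists 0%R => // k Sk; exists 0%R; rewrite mul0r.
  case: k Sk => [[|n] Sn //|n Sn]; first by case: no; exists n.
  by case: no; exists n; rewrite -[_%:Z%R]opprK -NegzE; apply: SN.
have exS : exists n, `[< S n.+1%:Z%R >] by exists n; apply/asboolP.
case: (ex_minnP exS) => d /asboolP Sd dmin; exists d.+1%:Z%R => // k Sk.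
exists (k %/ d.+1)%Z; rewrite [LHS](divz_eq k d.+1).
suff -> : (k %% d.+1)%Z = 0%R by rewrite addr0.
have : S (k %% d.+1)%Z by apply: SB => //; apply: SM.
have := @modz_ge0 k d.+1 isT; have := @ltz_pmod k d.+1 isT.
case: (k %% d.+1)%Z => [[//|r]|//] rd _ Sr.
by have := dmin r (introT (asboolP _) Sr); lia.
Qed.

(** * Homomorphisms to Z and the Euclidean algorithm on generators *)

Section IntegerCharacter.
Variables (G : groupType) (f : G -> int).
Hypothesis fM : forall x y, f (x * y) = (f x + f y)%R.

Lemma char1 : f 1 = 0%R.
Proof. by apply: (@addIr _ (f 1)); rewrite -fM mul1g add0r. Qed.

Lemma charV x : f x^-1 = (- f x)%R.
Proof. by apply: (@addIr _ (f x)); rewrite -fM mulVg char1 addNr. Qed.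

Lemma charZ x k : f (zexpg x k) = (k * f x)%R.
Proof.
elim/int_rec: k => [|n IHn|n IHn]; first by rewrite mul0r char1.
  by rewrite intS zexpgS fM IHn; ring.
have -> : (- n.+1%:Z = - n%:Z - 1)%R by lia.
by rewrite zexpgP fM IHn charV; ring.
Qed.

Lemma char_ker_subgroup : is_subgroup [set x | f x = 0%R].
Proof.
apply/is_subgroupP; split; first exact: char1.
by move=> x y /= fx fy; rewrite fM charV fx fy subrr.
Qed.

(** One Euclidean step is the invertible move from (x, y) to (y, x y^-q), with q the quotient of f x
    by f y. It makes the second value a remainder modulo f y, so the induction is on a bound for |f
    y|. *)
Lemma euclid_pair x y : exists x' y', f y' = 0%R /\
  generated [set` [:: x'; y']] = generated [set` [:: x; y]].
Proof.
move: {2}`|f y|%N.+1 (ltnSn `|f y|%N) => n.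
elim: n x y => // n IHn x y; rewrite ltnS => lefn.
have [fy0|fy0] := eqVneq (f y) 0%R; first by exists x, y.
pose z := x * zexpg y (- (f x %/ f y)%Z)%R.
have fz : f z = (f x %% f y)%Z by rewrite fM charZ /modz; ring.
have [|x' [y' [fy' gen']]] := IHn y z.
  rewrite fz; have := ltz_mod (f x) fy0; have := modz_ge0 (f x) fy0; lia.
exists x', y'; split=> //; rewrite gen'.
have sg := generated_subgroup.
have gyz : generated [set` [:: y; z]] y by apply: mem_generated; rewrite !inE eqxx.
have gxy : generated [set` [:: x; y]] y by apply: mem_generated; rewrite !inE eqxx orbT.
apply: generated_eq => w /=; rewrite !inE => /orP[]/eqP-> //.
  apply: (subgroupM (sg _ _)); last exact: (subgroupZ (sg _ _) _).
  by apply: mem_generated; rewrite inE eqxx.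
have -> : x = z * zexpg y (f x %/ f y)%Z.
  by rewrite /z zexpgN mulgVK.
apply: (subgroupM (sg _ _)); last exact: (subgroupZ (sg _ _) _).
by apply: mem_generated; rewrite !inE eqxx orbT.
Qed.

(* Nielsen moves: the Euclidean algorithm applied to the values of f on a
   generating sequence. *)
Lemma euclid_generators x s : exists x' s', [/\ size s' = size s,
  generated [set` x' :: s'] = generated [set` x :: s] &
  forall y, y \in s' -> f y = 0%R].
Proof.
elim: s x => [|y s IHs] x; first by exists x, [::].
(* The tail is reduced first, so that [y1] is its only entry possibly outside ker f; the pair (x,
   y1) is then reduced. *)
have [y1 [s1 [sz1 gen1 f1]]] := IHs y.
have [x' [y' [fy' gen']]] := euclid_pair x y1.
exists x', (y' :: s1); split; first by rewrite /= sz1.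
  rewrite -(generated_cons_eq x gen1).
  have swap u v (t w : seq G) a : generated [set` [:: u; v]] = generated [set` w] ->
      a \in w -> generated [set` [:: u, v & t]] a.
    move=> uvw /mem_generated; rewrite -uvw; apply: generated_mono => b /=.
    by rewrite !inE => /orP[]/eqP->; apply: mem_generated; rewrite !inE eqxx ?orbT.
  apply: generated_eq => a /=; rewrite !inE orbA => /orP[aw|sa];
    try by apply: mem_generated; rewrite !inE sa !orbT.
    by apply: swap (esym gen') _; rewrite !inE.
  by apply: swap gen' _; rewrite !inE.
by move=> z; rewrite inE => /orP[/eqP->|/f1].
Qed.

End IntegerCharacter.

(** Induction on s: modulo <s>, the group H is generated by one element h = x^d r0, and H & <s>
    needs at most as many generators as s has entries. *)
Lemma subgroup_generated_abelian (G : groupType) (s : seq G) (H : set G) :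
  (forall x y, generated [set` s] x -> generated [set` s] y -> commute x y) ->
  is_subgroup H -> (forall x, H x -> generated [set` s] x) ->
  generated_by_n H (size s).
Proof.
elim: s H => [|x s IHs] H cs sgH Hs.
  exists [::]; split=> //; apply/seteqP; split=> [y|y /Hs //].
  exact: (generated_min sgH).
have gx : generated [set` x :: s] x by apply: mem_generated; rewrite inE eqxx.
have gs y := @generated_cons_sub _ x s y.
have sgs := generated_subgroup [set` s].
have sgxs := generated_subgroup [set` x :: s].
(* The exponents that x takes in elements of H form a subgroup dZ, even when x has finite order and
   the exponents are not unique. *)
have [||d [r0 [sr0 Hh]] Sd] := @int_subgroup_principal
  (fun k => exists r, generated [set` s] r /\ H (zexpg x k * r)).
- by exists 1; split; [apply: (subgroup1 sgs)|rewrite mulg1; apply: (subgroup1 sgH)].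
- move=> k l [r [sr Hr]] [q [sq Hq]]; exists (r / q); split.
    exact: (subgroupF sgs).
  have -> : zexpg x (k - l) * (r / q) = (zexpg x k * r) / (zexpg x l * q).
    rewrite zexpgD zexpgN invgM -!mulgA; congr (_ * _).
    rewrite [RHS]mulgA; apply: cs; last by apply: gs; apply: (subgroupF sgs).
    by apply: (subgroupV sgxs); apply: (subgroupZ sgxs _).
  exact: (subgroupF sgH).
set h := zexpg x d * r0 in Hh *.
have [t [szt gent]] : generated_by_n (H `&` generated [set` s]) (size s).
  apply: IHs => [y z /gs gy /gs gz||y []//]; first exact: cs.
  exact: subgroupI.
exists (h :: t); split; first by rewrite /= szt.
apply: (generated_cyclic_ext sgH Hh gent) => g Hg.
have [|k [r [sr defg]]] := @generated_cons_normal _ x s _ g (Hs g Hg).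
  move=> y k sy; suff -> : y ^ zexpg x k = y by [].
  by rewrite conjgE (cs y) ?mulKg //; [apply: gs|apply: (subgroupZ sgxs _)].
have [|m defk] := Sd k; first by exists r; rewrite -defg.
(* As k = m d, multiplying g = x^k r by h^-m cancels the power of x and leaves an element of <s>. *)
exists (- m)%R; rewrite /h zexpgMl; last first.
  by apply: cs; [apply: (subgroupZ sgxs _)|apply: gs].
have -> : zexpg (zexpg x d) (- m) = (zexpg x k)^-1.
  by rewrite -zexpgN defk -mulNr zexpgA.
rewrite defg mulgA (cs (zexpg x k) r) ?mulgK; last exact: gs.
  by apply: (subgroupM sgs) => //; apply: (subgroupZ sgs _).
exact: (subgroupZ sgxs _).
Qed.

(** Phrased with [generated_by_n] rather than [rk], so that it yields the finite generation of H
    together with the bound on its rank. *)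
Definition finite_rank_monotone (G : groupType) : Prop :=
  forall (K H : set G) n, generated_by_n K n -> is_subgroup H ->
    (forall x, H x -> K x) -> generated_by_n H n.

(** * Subgroups when conjugation fixes or inverts each element of an abelian kernel *)

Section DihedralCharacter.
Variables (G : groupType) (f : G -> int).
Hypothesis fM : forall x y, f (x * y) = (f x + f y)%R.
Hypothesis ker_abelian : forall x y, f x = 0%R -> f y = 0%R -> commute x y.
Hypothesis ker_conj : forall x y, f x = 0%R -> x ^ y = x \/ x ^ y = x^-1.

Lemma ker_generated_normal (s : seq G) x y : (forall z, z \in s -> f z = 0%R) ->
  generated [set` s] x -> generated [set` s] (x ^ y).
Proof.
move=> fs sx; have sgs := generated_subgroup [set` s].
have fx : f x = 0%R by apply: (generated_min (char_ker_subgroup fM)) sx.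
by have [->|->] := ker_conj y fx => //; apply: (subgroupV sgs).
Qed.

Lemma subgroup_generated_ker (s : seq G) (H : set G) : (forall z, z \in s -> f z = 0%R) ->
  is_subgroup H -> (forall x, H x -> generated [set` s] x) ->
  generated_by_n H (size s).
Proof.
move=> fs sgH Hs; apply: subgroup_generated_abelian => //.
have kers x : generated [set` s] x -> f x = 0%R.
  exact: (generated_min (char_ker_subgroup fM)).
by move=> x y /kers fx /kers fy; apply: ker_abelian.
Qed.

Lemma dihedral_finite_rank_monotone : finite_rank_monotone G.
Proof.
move=> K H [|n] [s [szs <-]] sgH Hs.
  rewrite -szs; apply: subgroup_generated_ker => // z.
  by rewrite (size0nil szs).
case: s szs Hs => // x0 s0 [szs] Hs.
have [x [s [sz gens fs]]] := euclid_generators fM x0 s0.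
rewrite -{}gens in Hs; rewrite -{}szs -{}sz {x0 s0 n}.
(* If f x = 0, all of K lies in the abelian group ker f, and the abelian bound applies to x :: s
   itself. *)
have [fx0|fx0] := eqVneq (f x) 0%R.
  apply: (@subgroup_generated_ker (x :: s)) => // z.
  by rewrite inE => /orP[/eqP->|/fs].
(* The image f(H) is dZ, and h is a preimage of d in H: the one generator needed besides those of H
   & ker f. *)
have [||d [h Hh fh] Sd] := @int_subgroup_principal (fun k => exists2 g, H g & f g = k).
- by exists 1; [apply: (subgroup1 sgH)|apply: char1].
- move=> k l [g Hg <-] [g' Hg' <-]; exists (g / g'); first exact: (subgroupF sgH).
  by rewrite fM charV.
pose A := [set z | f z = 0%R].
have [t [szt gent]] : generated_by_n (H `&` A) (size s).
  apply: subgroup_generated_ker => //.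
    by apply: subgroupI => //; apply: char_ker_subgroup.
  move=> g [Hg fg].
  have [|k [r [sr defg]]] := @generated_cons_normal _ x s _ g (Hs g Hg).
    by move=> y k; apply: ker_generated_normal.
  have fr : f r = 0%R.
    by apply: (generated_min (char_ker_subgroup fM)) sr.
  (* For g = x^k r in ker f this gives k f(x) = 0, hence k = 0 and g lies in <s>. *)
  move: fg; rewrite defg /A /= fM charZ // fr addr0 => /eqP.
  by rewrite mulf_eq0 (negPf fx0) orbF => /eqP->; rewrite mul1g.
exists (h :: t); split; first by rewrite /= szt.
apply: (generated_cyclic_ext sgH Hh gent) => g Hg.
have [|m fg] := Sd (f g); first by exists g.
by exists (- m)%R; rewrite /A /= fM charZ // fh fg mulNr subrr.
Qed.
End DihedralCharacter.

Lemma finite_rank_monotone_inert (G : groupType) (H : set G) :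
  finite_rank_monotone G -> is_subgroup H -> inert H.
Proof.
move=> mono sgH; split=> // K fgK.
have HK n : generated_by_n K n -> generated_by_n (H `&` K) n.
  move=> Kn; apply: (mono K) => //; last by move=> x [].
  by apply: subgroupI => //; case: Kn => s [_ <-]; apply: generated_subgroup.
have fgHK : finitely_generated (H `&` K) by case: fgK => n /HK; exists n.
(* Both sets are finitely generated, so neither rank is the default 0. *)
split=> //; rewrite /rk; case: pselect => // {}fgHK; case: pselect => // {}fgK.
case: ex_minnP => m _ minm; case: ex_minnP => n /asboolP /HK Kn _.
by apply/minm/asboolP.
Qed.

(** * Isomorphisms of direct products *)

Section Isomorphisms.
Implicit Types G H K L : groupType.

Section Bundle.
Variables (G H : groupType) (f : G -> H) (fM : {morph f : x y / x * y}).
(** The anonymous argument carries the proof, which lets the instance below bundle an arbitrary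
    function as a [{multiplicative G -> H}]. *)
Definition mult_of_morph of {morph f : x y / x * y} := f.
HB.instance Definition _ :=
  isMultiplicative.Build G H (mult_of_morph fM) fM.
End Bundle.

Lemma isomorphic_intro G H (f : G -> H) (g : H -> G) :
  {morph f : x y / x * y} -> cancel f g -> cancel g f -> isomorphic G H.
Proof. by move=> fM fK gK; exists (mult_of_morph fM); exists g. Qed.

Lemma isomorphic_elim G H : isomorphic G H ->
  exists (f : G -> H) (g : H -> G), [/\ {morph f : x y / x * y},
    {morph g : x y / x * y}, cancel f g & cancel g f].
Proof.
case=> f [g fK gK]; exists f, g; split=> // [x y|x y]; first exact: gmulfM.
by apply: (can_inj fK); rewrite gmulfM !gK.
Qed.

Lemma isomorphic_refl G : isomorphic G G.
Proof. exact: (@isomorphic_intro G G id id). Qed.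

Lemma isomorphic_sym G H : isomorphic G H -> isomorphic H G.
Proof. by case/isomorphic_elim=> f [g [fM gM fK gK]]; apply: isomorphic_intro gM gK fK. Qed.

Lemma isomorphic_trans H G K : isomorphic G H -> isomorphic H K -> isomorphic G K.
Proof.
case/isomorphic_elim=> f [f' [fM _ fK f'K]] /isomorphic_elim[g [g' [gM _ gK g'K]]].
apply: (@isomorphic_intro _ _ (g \o f) (f' \o g')); try exact: can_comp.
by move=> x y /=; rewrite fM gM.
Qed.

Lemma isomorphic_prod G H K L : isomorphic G H -> isomorphic K L ->
  isomorphic (G * K)%type (H * L)%type.
Proof.
case/isomorphic_elim=> f [f' [fM _ fK f'K]] /isomorphic_elim[g [g' [gM _ gK g'K]]].
apply: (@isomorphic_intro _ _ (fun x => (f x.1, g x.2)) (fun x => (f' x.1, g' x.2))).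
- by move=> [x1 x2] [y1 y2]; rewrite /= fM gM.
- by move=> [x1 x2] /=; rewrite fK gK.
- by move=> [x1 x2] /=; rewrite f'K g'K.
Qed.

Lemma isomorphic_prodC G H : isomorphic (G * H)%type (H * G)%type.
Proof.
apply: (@isomorphic_intro _ _ (fun x => (x.2, x.1)) (fun x => (x.2, x.1))); by move=> [].
Qed.

Lemma isomorphic_prodA G H K : isomorphic (G * (H * K))%type (G * H * K)%type.
Proof.
apply: (@isomorphic_intro _ _ (fun x => (x.1, x.2.1, x.2.2))
  (fun x => (x.1.1, (x.1.2, x.2)))) => //; first by move=> [? []].
by move=> [[]].
Qed.

Lemma isomorphic_prodACA G H K L :
  isomorphic (G * H * (K * L))%type (G * K * (H * L))%type.
Proof.
apply: (@isomorphic_intro _ _ (fun x => ((x.1.1, x.2.1), (x.1.2, x.2.2)))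
  (fun x => ((x.1.1, x.2.1), (x.1.2, x.2.2)))) => //; by move=> [[? ?] []].
Qed.

Lemma isomorphic_prod_power0 G H : isomorphic (power G 0 * H)%type H.
Proof.
apply: (@isomorphic_intro _ _ snd (fun x => (1, x))) => //.
by move=> [x y] /=; congr (_, _); apply/ffunP=> -[].
Qed.

Lemma isomorphic_power1 G : isomorphic (power G 1) G.
Proof.
apply: (@isomorphic_intro _ _ (fun x : power G 1 => x ord0)
  (fun x => [ffun=> x] : power G 1)).
- by move=> x y; rewrite ffunE.
- by move=> x; apply/ffunP=> i; rewrite ffunE (ord1 i).
- by move=> x; rewrite ffunE.
Qed.

Lemma isomorphic_powerD G m n :
  isomorphic (power G m * power G n)%type (power G (m + n)).
Proof.
apply: isomorphic_sym.
apply: (@isomorphic_intro _ _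
  (fun x : power G (m + n) => ([ffun i => x (lshift n i)] : power G m,
                               [ffun i => x (rshift m i)] : power G n))
  (fun x => [ffun k => match split k with inl i => x.1 i | inr i => x.2 i end])).
- by move=> x y; congr (_, _); apply/ffunP=> i; rewrite !ffunE.
- move=> x; apply/ffunP=> k; rewrite ffunE.
  by case: split_ordP => i ->; rewrite ffunE.
- move=> [x y]; congr (_, _); apply/ffunP=> i; rewrite !ffunE.
    by case: split_ordP => j /eqP; rewrite ?eq_lshift ?eq_lrshift // => /eqP->.
  by case: split_ordP => j /eqP; rewrite ?eq_rshift ?eq_rlshift // => /eqP->.
Qed.

Lemma isomorphic_direct_product_recl n (Gs : 'I_n.+1 -> groupType) :
  isomorphic (direct_product Gs)
    (Gs ord0 * direct_product (fun i : 'I_n => Gs (lift ord0 i)))%type.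
Proof.
(* The type of the value depends on k, hence the transports along e; equality proofs between
   ordinals are unique, so these transports reduce to the identity below. *)
pose cons (x : Gs ord0) (y : forall i : 'I_n, Gs (lift ord0 i)) k : Gs k :=
  match unliftP ord0 k with
  | UnliftSome i e => eq_rect_r Gs (y i) e
  | UnliftNone e => eq_rect_r Gs x e
  end.
have cons0 x y : cons x y ord0 = x.
  rewrite /cons; case: unliftP => [i e|e]; first by case/eqP: (neq_lift ord0 i).
  by rewrite (eq_irrelevance e erefl).
have consS x y i : cons x y (lift ord0 i) = y i.
  rewrite /cons; case: unliftP => [j e|e]; last by case/esym/eqP/negPn: (e); rewrite neq_lift.
  have eij := lift_inj e; case: _ / eij e => e.
  by rewrite (eq_irrelevance e erefl).
apply: (@isomorphic_intro _ _
  (fun x : direct_product Gs => (x ord0, [ffun i => x (lift ord0 i)] :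
     direct_product (fun i : 'I_n => Gs (lift ord0 i))))
  (fun x => [ffun k => cons x.1 x.2 k])).
- by move=> x y; congr (_, _); [rewrite ffunE|apply/ffunP=> i; rewrite !ffunE].
- move=> x; apply/ffunP=> k; rewrite ffunE /=.
  by case: (unliftP ord0 k) => [i ->|->]; rewrite ?cons0 // consS ffunE.
- move=> [x y]; congr (_, _); first by rewrite ffunE cons0.
  by apply/ffunP=> i; rewrite !ffunE consS.
Qed.
End Isomorphisms.

(** * A model of the Klein bottle group *)

Section PresentedGroup.
Variables (X : choiceType) (R : set (word X)) (H : groupType) (f : X -> H).

Definition letter_eval (l : X * bool) : H := if l.2 then (f l.1)^-1 else f l.1.
Definition word_eval (w : word X) : H := foldr (fun l y => letter_eval l * y) 1 w.

Lemma word_eval_cat v w : word_eval (v ++ w) = word_eval v * word_eval w.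
Proof. by elim: v => [|l v IHv] /=; rewrite ?mul1g // IHv mulgA. Qed.

Hypothesis fR : forall r, R r -> word_eval r = 1.

Lemma pres_eq_eval v w : pres_eq R v w -> word_eval v = word_eval w.
Proof.
elim=> // [u {}v {}w _ -> _ -> //|u {}v u' v' _ eu _ ev|x b].
  by rewrite !word_eval_cat eu ev.
by case: b; rewrite /= /letter_eval /= mulg1 ?mulgV ?mulVg.
Qed.

(** The map of von Dyck's theorem. The choice of [repr x] is immaterial because evaluation is
    constant on congruence classes. *)
Definition pres_eval (x : presented R) : H := word_eval (repr x).

Lemma pres_eval_class w : pres_eval (pres_class R w) = word_eval w.
Proof. by apply/pres_eq_eval/pres_classP; rewrite pres_class_repr. Qed.

Lemma pres_evalM : {morph pres_eval : x y / x * y}.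
Proof.
move=> x y; rewrite -[x]pres_class_repr -[y]pres_class_repr.
have -> : pres_class R (repr x) * pres_class R (repr y) =
  pres_class R (repr x ++ repr y) by exact: pres_classM.
by rewrite !pres_eval_class word_eval_cat.
Qed.
End PresentedGroup.

(** Induction on a representing word; by cancellation the letter (a, true) is the inverse of the
    class of (a, false). *)
Lemma presented_ind (X : choiceType) (R : set (word X)) (P : presented R -> Prop) :
  P 1 -> (forall a x, P x -> P (pres_class R [:: (a, false)] * x)) ->
  (forall a x, P x -> P ((pres_class R [:: (a, false)])^-1 * x)) ->
  forall x, P x.
Proof.
move=> P1 PM PV x; rewrite -[x]pres_class_repr.
elim: (repr x) => [//|[a b] w IHw].
have clM u v : pres_class R (u ++ v) = pres_class R u * pres_class R v.
  by apply/esym/pres_classM.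
rewrite -cat1s clM; case: b; last exact: PM.
suff -> : pres_class R [:: (a, true)] = (pres_class R [:: (a, false)])^-1 by apply: PV.
apply/esym/mulg1_eq; rewrite -clM; apply/pres_classP; exact: pres_cancel.
Qed.

(** This is (-1)^k for k of either sign: conjugation by b^k raises a to this power. *)
Definition ksign (k : int) : int := if odd (absz k) then (-1)%R else 1%R.

Lemma ksignD k l : ksign (k + l)%R = (ksign k * ksign l)%R.
Proof.
have e : odd (absz (k + l)%R) = odd (absz k) (+) odd (absz l) by lia.
by rewrite /ksign e; case: (odd (absz k)); case: (odd (absz l)).
Qed.

Lemma ksignN k : ksign (- k)%R = ksign k.
Proof. by rewrite /ksign abszN. Qed.

Lemma ksignK k : (ksign k * ksign k = 1)%R.
Proof. by rewrite /ksign; case: ifP. Qed.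

(* The Klein bottle group in normal form: (i, j) stands for a^i b^j. *)
Definition klein : Type := (int * int)%type.
HB.instance Definition _ := Choice.on klein.

Section KleinGroup.
Implicit Types x y z : klein.
(** A semidirect product of Z by Z: moving b^j to the right past a^k turns a^k into a^((-1)^j k). *)
Definition klein_mul x y : klein := ((x.1 + ksign x.2 * y.1)%R, (x.2 + y.2)%R).
Definition klein_one : klein := (0%R, 0%R).
Definition klein_inv x : klein := ((- (ksign x.2 * x.1))%R, (- x.2)%R).

Fact klein_mulA : associative klein_mul.
Proof. by move=> x y z; congr (_, _); rewrite /= ?ksignD; ring. Qed.
Fact klein_mul1 : left_id klein_one klein_mul.
Proof. by move=> [i j]; rewrite /klein_mul /= mul1r !add0r. Qed.
Fact klein_mulr1 : right_id klein_one klein_mul.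
Proof. by move=> [i j]; rewrite /klein_mul /= mulr0 !addr0. Qed.
Fact klein_mulV : left_inverse klein_one klein_inv klein_mul.
Proof. by move=> [i j]; rewrite /klein_mul /= ksignN !addNr. Qed.
Fact klein_mulrV : right_inverse klein_one klein_inv klein_mul.
Proof.
by move=> [i j]; rewrite /klein_mul /= mulrN mulrA ksignK mul1r !subrr.
Qed.
HB.instance Definition _ := isGroup.Build klein
  klein_mulA klein_mul1 klein_mulr1 klein_mulV klein_mulrV.

Lemma klein_mulE x y : x * y = ((x.1 + ksign x.2 * y.1)%R, (x.2 + y.2)%R) :> klein.
Proof. by []. Qed.

Lemma klein_invE x : x^-1 = ((- (ksign x.2 * x.1))%R, (- x.2)%R) :> klein.
Proof. by []. Qed.

Lemma klein_zexpa k : zexpg ((1, 0)%R : klein) k = (k, 0%R).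
Proof.
elim/int_rec: k => [//|n IHn|n IHn].
  by rewrite intS zexpgS IHn klein_mulE /= mul1r addr0.
have -> : (- n.+1%:Z = - n%:Z - 1)%R by lia.
rewrite zexpgP IHn klein_mulE klein_invE /=.
by congr (_, _); rewrite ?oppr0 ?addr0 // !mul1r addrC.
Qed.

Lemma klein_zexpb k : zexpg ((0, 1)%R : klein) k = (0%R, k).
Proof.
elim/int_rec: k => [//|n IHn|n IHn].
  by rewrite intS zexpgS IHn klein_mulE /= mulr0 addr0.
have -> : (- n.+1%:Z = - n%:Z - 1)%R by lia.
rewrite zexpgP IHn klein_mulE klein_invE /=.
by congr (_, _); rewrite ?mulr0 ?oppr0 ?addr0 // addrC.
Qed.
End KleinGroup.

Section Morphisms.
Variables (G H : groupType) (f : G -> H).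
Hypothesis fM : {morph f : x y / x * y}.

Lemma morph_one : f 1 = 1.
Proof. by apply: (@mulgI _ (f 1)); rewrite -fM !mulg1. Qed.

Lemma morph_inv x : f x^-1 = (f x)^-1.
Proof. by apply: (@mulgI _ (f x)); rewrite -fM !mulgV morph_one. Qed.

Lemma morph_zexpg k x : f (zexpg x k) = zexpg (f x) k.
Proof.
have fX n : f (x ^+ n) = f x ^+ n.
  by elim: n => [|n IHn]; [apply: morph_one|rewrite !expgS fM IHn].
by case: k => n /=; rewrite ?morph_inv fX.
Qed.
End Morphisms.

(** The presentation gives f from [NS2] to [klein], and g sends (i, j) to a^i b^j. A computation
    shows that f after g is the identity, so it remains to see that g is onto, that is, that every
    element has a normal form. *)
Lemma NS2_isomorphic_klein : isomorphic NS2 klein.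
Proof.
pose v (i : 'I_2) : klein := if i == ord0 then (1, 0)%R else (0, 1)%R.
have vR (r : word 'I_2) : [set klein_relator] r -> word_eval v r = 1 by move=> ->.
pose f : NS2 -> klein := pres_eval v.
have fM : {morph f : x y / x * y} := pres_evalM vR.
pose a : NS2 := pres_class _ [:: (ord0, false)].
pose b : NS2 := pres_class _ [:: (ord_max, false)].
have fa : f a = (1, 0)%R by rewrite /f /a pres_eval_class.
have fb : f b = (0, 1)%R by rewrite /f /b pres_eval_class.
pose g (x : klein) : NS2 := zexpg a x.1 * zexpg b x.2.
have gK : cancel g f.
  move=> [i j]; rewrite /g fM !(morph_zexpg fM) fa fb klein_zexpa klein_zexpb.
  by rewrite klein_mulE /= mulr0 addr0 add0r.
(* The relator read as a conjugation: x ^ y is y^-1 x y, so the left side is b a b^-1. *)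
have ab : a ^ b^-1 = a^-1.
  have clM (u w : word 'I_2) : pres_class [set klein_relator] (u ++ w) =
      pres_class _ u * pres_class _ w by apply/esym/pres_classM.
  have bV : b^-1 = pres_class [set klein_relator] [:: (ord_max, true)].
    by apply: mulg1_eq; rewrite -clM; apply/pres_classP; apply: pres_cancel.
  suff e : a ^ b^-1 * a = 1 by rewrite -[LHS]invgK (mulg1_eq e).
  have : pres_class [set klein_relator] ([:: (ord_max, false)] ++
      [:: (ord0, false)] ++ [:: (ord_max, true)] ++ [:: (ord0, false)]) = 1.
    by apply/pres_classP; apply: (@pres_rel _ [set klein_relator] klein_relator).
  by rewrite !clM -bV conjgE invgK !mulgA.
have aVb : a ^ b = a^-1.
  by apply: (@conjg_inj _ b^-1); rewrite conjgK conjVg ab invgK.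
have ba k : b * zexpg a k = zexpg a (- k) * b.
  by rewrite conjgCV conj_zexpg ab -[a^-1]/(zexpg a (-1)) zexpgA mulrN1.
have bVa k : b^-1 * zexpg a k = zexpg a (- k) * b^-1.
  rewrite [LHS]conjgCV conj_zexpg invgK aVb -[a^-1]/(zexpg a (-1)) zexpgA mulrN1 //.
(* The normal forms a^k b^l are stable under left multiplication by a, b and their inverses, by the
   rules [ba] and [bVa]. *)
have gsurj x : exists y, x = g y.
  elim/presented_ind: x => [|i _ [[k l] ->]|i _ [[k l] ->]].
  - by exists (0, 0)%R; rewrite /g mulg1.
  - have [->|->] : i = ord0 \/ i = ord_max.
      by case: i => -[|[]] // lti; [left|right]; apply: val_inj.
    + by exists (1 + k, l)%R; rewrite /g /= zexpgS mulgA.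
    + by exists (- k, 1 + l)%R; rewrite /g /= zexpgS mulgA ba -mulgA.
  - have [->|->] : i = ord0 \/ i = ord_max.
      by case: i => -[|[]] // lti; [left|right]; apply: val_inj.
    + by exists (k - 1, l)%R; rewrite /g /= zexpgP mulgA.
    + by exists (- k, l - 1)%R; rewrite /g /= zexpgP mulgA bVa -mulgA.
apply: (isomorphic_intro fM (g := g)) => // x.
by have [y ->] := gsurj x; rewrite gK.
Qed.

(** * Products of Euclidean surface groups *)

Implicit Types G H K L : groupType.

Definition indicable (G : groupType) : Prop :=
  exists h : G -> int,
    (forall x y, h (x * y) = (h x + h y)%R) /\ exists t, h t = 1%R.

Definition of_type_euc1 (G : groupType) : Prop :=
  exists p q : nat, isomorphic G (power Zgroup p * power C2 q)%type.

Definition of_type_euc2 (G : groupType) : Prop :=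
  exists q : nat, isomorphic G (NS2 * power C2 q)%type.

Definition of_type_NS2_indicable (G : groupType) : Prop :=
  exists H : groupType, isomorphic G (NS2 * H)%type /\ indicable H.

(** A trichotomy that is stable under direct products. The first two cases are those of (c); the
    third is the one in which (b) is refuted. *)
Definition euclidean_type (G : groupType) : Prop :=
  [\/ of_type_euc1 G, of_type_euc2 G | of_type_NS2_indicable G].

Lemma indicable_iso G H :
  isomorphic G H -> indicable H -> indicable G.
Proof.
case/isomorphic_elim=> f [g [fM _ _ gK]] [h [hM [t ht]]]; exists (h \o f).
by split=> [x y|]; [rewrite /= fM hM|exists (g t); rewrite /= gK].
Qed.

Lemma indicable_prodl G H : indicable G -> indicable (G * H)%type.
Proof.
case=> h [hM [t ht]]; exists (h \o fst); split; last by exists (t, 1).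
by move=> x y; apply: hM.
Qed.

Lemma indicable_prodr G H : indicable H -> indicable (G * H)%type.
Proof.
case=> h [hM [t ht]]; exists (h \o snd); split; last by exists (1, t).
by move=> x y; apply: hM.
Qed.

Lemma indicable_power p : indicable (power Zgroup p.+1).
Proof.
exists (fun x : power Zgroup p.+1 => x ord0 : int); split=> [x y|]; first by rewrite ffunE.
by exists ([ffun=> 1%R : int] : power Zgroup p.+1); rewrite ffunE.
Qed.

Lemma indicable_NS2 : indicable NS2.
Proof.
apply: indicable_iso NS2_isomorphic_klein _.
by exists (fun x : klein => x.2); split=> //; exists (0%R, 1%R).
Qed.

Lemma euclidean_type_iso G H : isomorphic G H -> euclidean_type H -> euclidean_type G.
Proof.
move=> GH [[p [q e]]|[q e]|[K [e hK]]].
- by apply: Or31; exists p, q; apply: isomorphic_trans GH e.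
- by apply: Or32; exists q; apply: isomorphic_trans GH e.
- by apply: Or33; exists K; split=> //; apply: isomorphic_trans GH e.
Qed.

Lemma of_type_NS2_indicable_prodl G H : of_type_NS2_indicable G -> of_type_NS2_indicable (G * H)%type.
Proof.
case=> K [e hK]; exists (K * H)%type; split; last exact: indicable_prodl.
apply: isomorphic_trans (isomorphic_sym (isomorphic_prodA _ _ _)).
exact: isomorphic_prod (isomorphic_refl _).
Qed.

Lemma of_type_euc2_prodl G H : of_type_euc2 G -> indicable H ->
  of_type_NS2_indicable (G * H)%type.
Proof.
case=> q e hH; exists (power C2 q * H)%type; split; last exact: indicable_prodr.
apply: isomorphic_trans (isomorphic_sym (isomorphic_prodA _ _ _)).
exact: isomorphic_prod (isomorphic_refl _).
Qed.

Lemma indicable_euc2 G : of_type_euc2 G -> indicable G.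
Proof.
by case=> q e; apply: indicable_iso e _; apply/indicable_prodl/indicable_NS2.
Qed.

(** The free rank p of H decides: for p = 0 the powers of Z/2 merge, while for p > 0 a factor Z
    makes the complement of [NS2] indicable. *)
Lemma euc2_prod_euc1 G H : of_type_euc2 G -> of_type_euc1 H -> euclidean_type (G * H)%type.
Proof.
move=> eG [[|p] [q eH]].
  case: eG => r eG; apply: Or32; exists (r + q)%N.
  apply: isomorphic_trans (isomorphic_prod eG (isomorphic_trans eH (isomorphic_prod_power0 _ _))) _.
  apply: isomorphic_trans (isomorphic_sym (isomorphic_prodA _ _ _)) _.
  exact: isomorphic_prod (isomorphic_refl _) (isomorphic_powerD _ _ _).
apply: Or33; apply: of_type_euc2_prodl eG _; apply: indicable_iso eH _.
exact/indicable_prodl/indicable_power.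
Qed.

Lemma euclidean_type_prod G H :
  euclidean_type G -> euclidean_type H -> euclidean_type (G * H)%type.
Proof.
have badl K L : of_type_NS2_indicable K -> euclidean_type (K * L)%type.
  by move=> bK; apply/Or33/of_type_NS2_indicable_prodl.
have C K L : euclidean_type (K * L)%type -> euclidean_type (L * K)%type.
  exact/euclidean_type_iso/isomorphic_prodC.
move=> [eG|eG|/badl//] [eH|eH|/badl/C//].
- case: eG eH => p [q eG] [p' [q' eH]]; apply: Or31; exists (p + p')%N, (q + q')%N.
  apply: isomorphic_trans (isomorphic_prod eG eH) _.
  apply: isomorphic_trans (isomorphic_prodACA _ _ _ _) _.
  exact: isomorphic_prod (isomorphic_powerD _ _ _) (isomorphic_powerD _ _ _).
- exact/C/euc2_prod_euc1.
- exact: euc2_prod_euc1.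
(* A second factor [NS2] maps onto Z by the exponent of b. *)
- exact/Or33/of_type_euc2_prodl/indicable_euc2.
Qed.

Lemma isomorphic_trivial (G H : groupType) :
  (forall x : G, x = 1) -> (forall x : H, x = 1) -> isomorphic G H.
Proof.
move=> G1 H1; apply: (@isomorphic_intro _ _ (fun=> 1) (fun=> 1)) => [x y|x|x].
- by rewrite mulg1.
- by rewrite (G1 x).
- by rewrite (H1 x).
Qed.

Lemma of_type_euc1_trivial (G : groupType) : (forall x : G, x = 1) -> of_type_euc1 G.
Proof.
move=> G1; exists 0%N, 0%N; apply: isomorphic_trivial => // -[x y].
by congr (_, _); apply/ffunP=> -[].
Qed.

Lemma isomorphic_prod_power0r (G H : groupType) : isomorphic H (H * power G 0)%type.
Proof.
apply: isomorphic_trans (isomorphic_prodC _ _).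
exact/isomorphic_sym/isomorphic_prod_power0.
Qed.

Lemma euclidean_type_Z : euclidean_type Zgroup.
Proof.
apply: Or31; exists 1%N, 0%N; apply: isomorphic_trans (isomorphic_prod_power0r _ _).
exact/isomorphic_sym/isomorphic_power1.
Qed.

Lemma euclidean_type_surface G : euclidean_surface_group G -> euclidean_type G.
Proof.
case=> [|[|[|[|]]]] e; apply: euclidean_type_iso e _.
- by apply/Or31/of_type_euc1_trivial => x; rewrite [x]ord1.
- exact: euclidean_type_Z.
- exact: euclidean_type_prod euclidean_type_Z euclidean_type_Z.
- apply: Or31; exists 0%N, 1%N; apply: isomorphic_sym.
  exact: isomorphic_trans (isomorphic_prod_power0 _ _) (isomorphic_power1 _).
- by apply: Or32; exists 0%N; apply: isomorphic_prod_power0r.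
Qed.

Lemma euclidean_type_direct_product n (Gs : 'I_n -> groupType) :
  (forall i, euclidean_surface_group (Gs i)) -> euclidean_type (direct_product Gs).
Proof.
elim: n Gs => [|n IHn] Gs eG.
  by apply/Or31/of_type_euc1_trivial => x; apply/ffunP=> -[].
apply: euclidean_type_iso (isomorphic_direct_product_recl Gs) _.
by apply: euclidean_type_prod; [apply: euclidean_type_surface|apply: IHn].
Qed.

(** * Inertness in the groups of (c) *)

Lemma Fix_subgroup (G : groupType) (phi : {multiplicative G -> G}) : is_subgroup (Fix phi).
Proof.
apply/is_subgroupP; split; first exact/morph_one/gmulfM.
by move=> x y; rewrite /Fix /= gmulfM (morph_inv (@gmulfM _ _ phi)) => -> ->.
Qed.

(** Thanks to this, b, which inverts a and centralises (Z/2)^q, inverts every element of <a> x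
    (Z/2)^q. *)
Lemma C2_power_invg q (x : power C2 q) : x^-1 = x.
Proof.
apply/ffunP=> i; rewrite ffunE; move: (x i) => y.
by case: y => -[|[|]] // lty; apply: val_inj.
Qed.

Lemma C2_power_commute q (x y : power C2 q) : commute x y.
Proof. by apply/ffunP=> i; rewrite !ffunE; apply: addrC. Qed.

Lemma finite_rank_monotone_euc1 G : of_type_euc1 G -> finite_rank_monotone G.
Proof.
case=> p [q /isomorphic_elim[F [F' [FM _ FK _]]]].
have cG (x y : G) : commute x y.
  apply: (can_inj FK); rewrite !FM; congr (_, _); last exact: C2_power_commute.
  by apply/ffunP=> i; rewrite !ffunE; apply: addrC.
apply: (@dihedral_finite_rank_monotone _ (fun=> 0%R)) => // x y _.
by left; rewrite conjgE (cG x y) mulKg.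
Qed.

Lemma finite_rank_monotone_euc2 G : of_type_euc2 G -> finite_rank_monotone G.
Proof.
case=> q e; have {e} : isomorphic G (klein * power C2 q)%type.
  apply: isomorphic_trans e _.
  exact: isomorphic_prod NS2_isomorphic_klein (isomorphic_refl _).
case/isomorphic_elim=> F [F' [FM _ FK _]].
apply: (@dihedral_finite_rank_monotone _ (fun x => (F x).1.2)).
- by move=> x y; rewrite FM.
- move=> x y fx fy; apply: (can_inj FK); rewrite !FM.
  case: (F x) (F y) fx fy => [[i j] c] [[k l] d] /= -> ->.
  congr (_, _); last exact: C2_power_commute.
  by rewrite !klein_mulE /= !mul1r addrC.
- move=> x y fx.
  have xy : x * y = y * x \/ x * y = y * x^-1.
    (* Conjugation by y inverts the kernel when y has odd exponent of b and centralises it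
       otherwise. *)
    case E: (odd (absz (F y).1.2)); [right|left]; apply: (can_inj FK); rewrite !FM ?(morph_inv FM);
      case: (F x) (F y) fx E => [[i j] c] [[k l] d] /= -> E;
      congr (_, _); rewrite ?klein_mulE ?klein_invE /= /ksign ?E /=;
      try (by congr (_, _); ring).
      have -> : c^-1 = c by apply: C2_power_invg.
      exact: C2_power_commute.
    exact: C2_power_commute.
  by case: xy => xy; [left|right]; rewrite conjgE xy mulKg.
Qed.

(** * A fixed subgroup that is not inert *)

Lemma rk_generated (G : groupType) (K : set G) :
  finitely_generated K -> generated_by_n K (rk K).
Proof.
move=> fgK; rewrite /rk; case: pselect => // {}fgK.
by case: ex_minnP => m /asboolP.
Qed.

Lemma rk_min (G : groupType) (K : set G) n : generated_by_n K n -> (rk K <= n)%N.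
Proof.
move=> Kn; rewrite /rk; case: pselect => // {}fgK.
by case: ex_minnP => m _; apply; apply/asboolP.
Qed.

(* The twist a |-> a, b |-> ab of the Klein bottle group fixes exactly the
   words a^i b^j with j even. *)
Definition klein_twist (x : klein) : klein :=
  ((x.1 + (odd (absz x.2))%:R)%R, x.2).

Definition klein_untwist (x : klein) : klein :=
  ((x.1 - (odd (absz x.2))%:R)%R, x.2).

(** Since (ab)^2 = b^2, only the parity of the exponent of b matters. With [j] the parity of j, the
    identity is [j + l] = [j] + (-1)^j [l]. *)
Lemma klein_twistM : {morph klein_twist : x y / x * y}.
Proof.
move=> [i j] [k l]; rewrite !klein_mulE /klein_twist /=; congr (_, _).
have -> : odd (absz (j + l)%R) = odd (absz j) (+) odd (absz l) by lia.
by rewrite /ksign; case: (odd (absz j)); case: (odd (absz l)) => /=; ring.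
Qed.

Lemma klein_twistK : cancel klein_twist klein_untwist.
Proof. by move=> [i j]; rewrite /klein_untwist /= addrK. Qed.

Lemma klein_untwistK : cancel klein_untwist klein_twist.
Proof. by move=> [i j]; rewrite /klein_twist /= subrK. Qed.

(** The images under c of m generators span c(H) over Q, which contains a multiple of each basis
    vector, so the span is Q^n and n <= m. The factor 2 is invertible in Q. *)
Lemma additive_rank_bound (G : groupType) (H : set G) n (c : G -> 'rV[rat]_n) m :
  generated_by_n H m ->
  (forall x y, H x -> H y -> c (x * y) = (c x + c y)%R) ->
  (forall k, exists2 x, H x & c x = (2%:R *: delta_mx 0 k)%R) ->
  (n <= m)%N.
Proof.
case=> s [<- gens] cM cn.
have sgH : is_subgroup H by rewrite -gens; apply: generated_subgroup.
pose M : 'M[rat]_(size s, n) := (\matrix_(i < size s) c (nth (1 : G)%g s i))%R.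
have c1 : c 1 = 0%R.
  by apply: (@addIr _ (c 1)); rewrite -cM ?mulg1 ?add0r //; apply: subgroup1.
(* Membership in H is carried through the induction because c is additive on H only. *)
have HM : forall x, H x -> H x /\ (c x <= M)%MS.
  rewrite -[X in forall x, X x -> _]gens; apply: (@generated_min _ _ [set x | H x /\ (c x <= M)%MS]).
    apply/is_subgroupP; split=> [|x y [Hx cx] [Hy cy]].
      by split; [apply: (subgroup1 sgH)|rewrite c1 sub0mx].
    have HV := subgroupV sgH Hy; split; first exact: (subgroupF sgH).
    rewrite cM // addmx_sub //.
    have -> : c y^-1 = (- c y)%R.
      by apply: (@addIr _ (c y)); rewrite -cM // mulVg addNr.
    by rewrite eqmx_opp.
  move=> x /= sx; split; first by rewrite -gens; apply: mem_generated.
  have ltx : (index x s < size s)%N by rewrite index_mem.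
  have <- : row (Ordinal ltx) M = c x by rewrite rowK /= nth_index.
  exact: row_sub.
have le1M : (1%:M%R <= M)%MS.
  apply/row_subP => k; have [x Hx cx] := cn k.
  have [_] := HM x Hx; rewrite cx row1 => /(scalemx_sub (2%:R)^-1).
  by rewrite scalerA mulVf ?scale1r.
by have := mxrankS le1M; rewrite mxrank1 => /leq_trans; apply; apply: rank_leq_row.
Qed.

Lemma of_type_NS2_indicable_not_inert (G : groupType) : of_type_NS2_indicable G ->
  exists2 phi : {multiplicative G -> G}, bijective phi & ~ inert (Fix phi).
Proof.
case=> H [e [h [hM [t ht]]]]; have {e} : isomorphic G (klein * H)%type.
  apply: isomorphic_trans e _.
  exact: isomorphic_prod NS2_isomorphic_klein (isomorphic_refl _).
case/isomorphic_elim=> F [F' [FM F'M FK F'K]].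
pose tw (x : klein * H) := (klein_twist x.1, x.2).
pose utw (x : klein * H) := (klein_untwist x.1, x.2).
have phiM : {morph F' \o tw \o F : x y / x * y}.
  by move=> x y; rewrite /= FM -F'M /tw /= klein_twistM.
exists (mult_of_morph phiM).
  exists (F' \o utw \o F) => x; rewrite /= /mult_of_morph /= F'K.
    by rewrite /tw /utw /= klein_twistK -[RHS]FK; case: (F x).
  by rewrite /tw /utw /= klein_untwistK -[RHS]FK; case: (F x).
(* For odd exponent of b the twist adds 1 to the exponent of a, so nothing there is fixed. *)
have FixP x : Fix (mult_of_morph phiM) x <-> ~~ odd (absz (F x).1.2).
  rewrite /Fix /= /mult_of_morph /=; split.
    move/(congr1 F); rewrite F'K; case: (F x) => -[i j] y /= [].
    by case: odd => //=; lia.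
  move=> ev; rewrite -[RHS]FK; congr F'; case: (F x) ev => -[i j] y /= /negPf ev.
  by rewrite /tw /klein_twist /= ev addr0.
case=> sgFix /(_ (generated [set` [:: F' ((0, 1)%R, 1); F' ((1, 0)%R, t)]])).
set u := F' ((0, 1)%R, 1); set v := F' ((1, 0)%R, t); set K := generated _.
have K2 : generated_by_n K 2 by exists [:: u; v].
case; first by exists 2%N.
move=> /rk_generated rkFix /leq_trans/(_ (rk_min K2)) le2.
have sgK : is_subgroup K := generated_subgroup _.
have Ku : K u by apply: mem_generated; rewrite !inE eqxx.
have Kv : K v by apply: mem_generated; rewrite !inE eqxx orbT.
have KV x : K x -> K x^-1 by apply: (subgroupV sgK).
have KM x y : K x -> K y -> K (x * y) by apply: (subgroupM sgK).
have Fu : F u = ((0, 1)%R, 1) by rewrite /u F'K.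
have Fv : F v = ((1, 0)%R, t) by rewrite /v F'K.
(* Here u is b and v is at; conjugation by b inverts a and fixes t, which separates a from t inside
   K up to squares. *)
have Fvu : F (v ^ u) = ((- 1, 0)%R, t).
  rewrite conjgE !FM (morph_inv FM) Fu Fv; congr (_, _).
  by rewrite /= mulg1 invg1 mul1g.
pose f x : seq int := [:: (F x).1.1; (F x).1.2; h (F x).2].
pose c x : 'rV[rat]_3 := (\row_(k < 3) (nth 0 (f x) k)%:~R)%R.
suff : (3 <= 2)%N by [].
(* The exponent of a is additive here because an even exponent of b in x makes the sign 1. *)
apply: leq_trans le2; apply: (additive_rank_bound (c := c)) (rkFix) _ _ => [x y [/FixP Fx _] _|k].
  apply/rowP=> -[[|[|[|//]]] ltk]; rewrite !mxE /f FM /= ?hM intrD //.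
  by rewrite /ksign (negPf Fx) mul1r.
have Kvu : K (v ^ u) by rewrite conjgE; apply: (KM _ _ (KV _ Ku)); apply: KM.
(* The witnesses are a^2 = v / v^u, b^2 = u u and t^2 = v v^u. *)
have [x Kx fx] : exists2 x, K x & f x = [seq (2 * (i == k :> nat)%:R)%R | i <- iota 0 3].
  case: k => -[|[|[|//]]] ltk.
  - exists (v / v ^ u); first by apply: KM => //; apply: KV.
    by rewrite /f FM (morph_inv FM) Fv Fvu /= mulgV (char1 hM).
  - exists (u * u); first exact: KM.
    by rewrite /f FM Fu /= mulg1 (char1 hM).
  - exists (v * v ^ u); first exact: KM.
    by rewrite /f FM Fv Fvu /= hM ht.
exists x.
  split=> //; apply/FixP; have -> : (F x).1.2 = nth 0%R (f x) 1 by [].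
  by rewrite fx /=; case: (k : nat) => [|[|]].
apply/rowP=> j; rewrite !mxE fx (nth_map 0%N) ?size_iota // nth_iota // add0n.
by rewrite rmorphM eqxx /= natz -val_eqE; case: (_ == _).
Qed.

Theorem theorem1p14 (n : nat) (hn : (0 < n)%N) (Gs : 'I_n -> groupType)
    (hGs : forall i : 'I_n, euclidean_surface_group (Gs i)) :
  let G := direct_product Gs in
  [<-> forall phi : {multiplicative G -> G}, inert (Fix phi);
       forall phi : {multiplicative G -> G}, bijective phi -> inert (Fix phi);
       (exists p q : nat, isomorphic G (power Zgroup p * power C2 q)%type) \/
       (exists q : nat, isomorphic G (NS2 * power C2 q)%type)].
Proof.
move=> G; tfae.
- by move=> inG phi _; apply: inG.
(* The third case of the trichotomy supplies an automorphism that contradicts (b). *)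
- move=> inG; have [e|e|/of_type_NS2_indicable_not_inert[phi bphi []]] :=
    euclidean_type_direct_product hGs; [by left|by right|exact: inG].
- move=> eG phi; apply: finite_rank_monotone_inert; last exact: Fix_subgroup.
  by case: eG; [apply: finite_rank_monotone_euc1|apply: finite_rank_monotone_euc2].
Qed.
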